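(* Let $A$ and $B$ be densely defined closeable operators in a Hilbert space such that $D(AB)$ is dense. Then $$(AB)^* \supset B^*A^*.$$ If also $D(B^*A^* )$ is dense, then $AB$ and $\overline{A}\,\overline{B}$ are closeable and all of the following relations hold: $$(B^*A^* )^* \supset (AB)^{**} = \overline{AB} \supset AB,$$ $$(B^*A^* )^* \supset A^{**}B^{**} = \overline{A}\,\overline{B} \supset AB,$$ $$(AB)^* = (\overline{AB})^* = (AB)^{***} \supset (B^*A^* )^{**} \supset B^*A^* = (\overline{B})^*(\overline{A})^*,$$ $$(AB)^* \supset (\overline{A}\,\overline{B})^* = (A^{**}B^{**})^* \supset B^*A^* = (\overline{B})^*(\overline{A})^*,$$ $$\overline{AB} = (\overline{AB})^{**} \subset (B^*A^* )^{***} = (B^*A^* )^* = (\overline{B^*A^*})^* = (\overline{\overline{B}^*\,\overline{A}^*})^*,$$ $$\overline{AB} \subset (\overline{A}\,\overline{B})^{**} = (\overline{\overline{A}\,\overline{B}})^{**} = \overline{\overline{A}\,\overline{B}} \subset (B^*A^* )^*.$$ In particular, $\overline{AB}$ and $\overline{A}\,\overline{B}$ are both included between $AB$ and $(B^*A^* )^*$, i.e. $AB\subset\overline{AB}\subset (B^*A^* )^*$ and $AB\subset\overline{A}\,\overline{B}\subset (B^*A^* )^*$.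
   Context: Operators are linear, defined on linear subspaces (domains) $D(\cdot)$ of a Hilbert space, and not necessarily bounded. $S\subset T$ means $D(S)\subset D(T)$ and $T$ agrees with $S$ on $D(S)$; $T \supset S$ means $S\subset T$. The product $AB$ has domain $D(AB)=\{x\in D(B): Bx\in D(A)\}$. For a closeable operator $T$, $\overline{T}$ denotes its closure (minimal closed extension). $T^*$ is the adjoint of a densely defined $T$; $T^{**}=(T^* )^*$, $T^{***}=(T^{**})^*$. Also $\overline{B}^*$ means $(\overline{B})^*$. *)

(* Defs.v *)
From HB Require Import structures.
From mathcomp Require Import all_boot all_order all_algebra sesquilinear.
From mathcomp Require Import complex.
From mathcomp Require Import all_classical all_reals all_analysis.

Set Implicit Arguments.
Unset Strict Implicit.
Unset Printing Implicit Defensive.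
Import Order.TTheory GRing.Theory Num.Theory.
Import numFieldNormedType.Exports.
Local Open Scope classical_set_scope.
Local Open Scope ring_scope.

(* A Hilbert space is either real or complex; both cases are covered. *)
Variant scalar_kind := RealScalars | ComplexScalars.

Definition scalar (R : realType) (k : scalar_kind) : numFieldType :=
  match k with
  | RealScalars => R
  | ComplexScalars => R[i]%C
  end.

Definition conj_scalar (R : realType) (k : scalar_kind) :
    scalar R k -> scalar R k :=
  match k return scalar R k -> scalar R k with
  | RealScalars => idfun
  | ComplexScalars => @Num.conj R[i]%C
  end.
Arguments conj_scalar : clear implicits.

(* The inner product is linear in its first argument and conjugate-linear in
   the second one. *)
Record hilbertType (R : realType) (k : scalar_kind) := Hilbert {
  hilbert_space :> completeNormedModType (scalar R k);
  inner : {dot hilbert_space for conj_scalar R k};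
  inner_norm : forall x : hilbert_space, inner x x = `|x| ^+ 2
}.

Section Operators.
Context {R : realType} {k : scalar_kind} {H : hilbertType R k}.

(* Setting the underlying function to 0 outside the domain makes Leibniz
   equality coincide with equality of partially defined operators. *)
Record operator := Operator {
  dom : set H;
  op_fun :> H -> H;
  dom0 : dom 0;
  dom_linear : forall (a : scalar R k) x y,
    dom x -> dom y -> dom (a *: x + y);
  op_linear : forall (a : scalar R k) x y,
    dom x -> dom y -> op_fun (a *: x + y) = a *: op_fun x + op_fun y;
  op_out : forall x, ~ dom x -> op_fun x = 0
}.

HB.instance Definition _ := gen_eqMixin operator.
HB.instance Definition _ := gen_choiceMixin operator.

Definition op_ext (S T : operator) : Prop :=
  dom S `<=` dom T /\ forall x, dom S x -> T x = S x.

Lemma op_ext_anti (S T : operator) : op_ext S T -> op_ext T S -> S = T.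
Proof.
case: S => dS S S0 Sd Sl So; case: T => dT T T0 Td Tl To [/= ST eST] [/= TS _].
have ed : dS = dT by apply/seteqP; split.
subst dT; have ef : S = T.
  apply/funext => x; have [dx|ndx] := pselect (dS x); first by rewrite eST.
  by rewrite So // To.
by subst T; congr Operator; exact: Prop_irrelevance.
Qed.

Definition densely_defined (T : operator) : Prop := dense (dom T).

Definition graph (T : operator) : set (H * H) :=
  [set p | dom T p.1 /\ p.2 = T p.1].

Definition closed_op (T : operator) : Prop := closed (graph T).

Definition closeable (T : operator) : Prop :=
  exists S, closed_op S /\ op_ext T S.

Section Product.
Variables A B : operator.

Let pdom : set H := [set x | dom B x /\ dom A (B x)].
Let pfun (x : H) : H := if `[< pdom x >] then A (B x) else 0.

Let pfunE x : pdom x -> pfun x = A (B x).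
Proof. by rewrite /pfun => /asboolP ->. Qed.

Let pdom0 : pdom 0.
Proof.
have B0 : B 0 = 0.
  have := op_linear (-1) (dom0 B) (dom0 B).
  by rewrite scaler0 addr0 scaleN1r addNr.
by split; rewrite ?B0; exact: dom0.
Qed.

Let pdom_linear (a : scalar R k) x y :
  pdom x -> pdom y -> pdom (a *: x + y).
Proof.
move=> [Bx Ax] [By Ay]; split; first exact: dom_linear.
by rewrite op_linear//; exact: dom_linear.
Qed.

Let pfun_linear (a : scalar R k) x y : pdom x -> pdom y ->
  pfun (a *: x + y) = a *: pfun x + pfun y.
Proof.
move=> px py; rewrite !pfunE//; last exact: pdom_linear.
case: px py => [Bx Ax] [By Ay].
by rewrite (op_linear _ Bx By) (op_linear _ Ax Ay).
Qed.

Let pfun_out x : ~ pdom x -> pfun x = 0.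
Proof. by rewrite /pfun => /asboolPn /negbTE ->. Qed.

Definition op_mul : operator :=
  Operator pdom0 pdom_linear pfun_linear pfun_out.

End Product.

Definition is_adjoint (T S : operator) : Prop :=
  forall y z : H, (dom S y /\ S y = z) <->
    (forall x, dom T x -> inner H (T x) y = inner H x z).

(* The adjoint of T is the operator S with is_adjoint T S; it exists as soon
   as T is densely defined (adjointP below), the value T being a dummy. *)
Definition adjoint (T : operator) : operator :=
  xget T [set S | is_adjoint T S].

Definition is_op_closure (T S : operator) : Prop :=
  [/\ closed_op S, op_ext T S &
      forall S', closed_op S' -> op_ext T S' -> op_ext S S'].

(* Minimal closed extension; it exists as soon as T is closeable
   (op_closureP below), the value T being a dummy. *)
Definition op_closure (T : operator) : operator :=
  xget T [set S | is_op_closure T S].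

Lemma dense_orthogonal (D : set H) (z : H) :
  dense D -> (forall x, D x -> inner H x z = 0) -> z = 0.
Proof.
move=> dD oz; apply/eqP/negP => /negP z0.
have nz : 0 < `|z| by rewrite normr_gt0.
have [|x [zx Dx]] := dD (ball z `|z|) _ (ball_open z _).
  by exists z; exact: ballxx.
move: zx; rewrite -ball_normE /= => zx.
have : `|z - x| ^+ 2 < `|z| ^+ 2 by rewrite ltr_pXn2r// nnegrE.
have zx0 : inner H z x = 0.
  have -> : inner H z x = (-1) ^+ false * conj_scalar R k (inner H x z).
    exact: hermitian_subproof.
  rewrite oz// expr0 mul1r.
  by rewrite /conj_scalar; case: (k) => //; rewrite rmorph0.
rewrite -!inner_norm linearBl/= !linearBr/= zx0 (oz x Dx) subr0 sub0r opprK.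
by rewrite gtrDl inner_norm le_gtF ?exprn_ge0.
Qed.

Lemma adjointP (T : operator) :
  densely_defined T -> is_adjoint T (adjoint T).
Proof.
move=> dT; suff [S hS] : exists S, is_adjoint T S.
  exact: (xgetPex T (ex_intro _ S hS)).
pose rel (y z : H) := forall x, dom T x -> inner H (T x) y = inner H x z.
have relP y z z' : rel y z -> rel y z' -> z = z'.
  move=> yz yz'; apply/eqP; rewrite -subr_eq0; apply/eqP.
  apply: (dense_orthogonal dT) => x Tx.
  by rewrite linearBr/= -yz// -yz'// subrr.
have rel_lin (a : scalar R k) y y' z z' : rel y z -> rel y' z' ->
    rel (a *: y + y') (a *: z + z').
  by move=> yz yz' x Tx; rewrite !linearPr/= yz// yz'.
pose D : set H := [set y | exists z, rel y z].
pose f (y : H) : H := xget 0 [set z | rel y z].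
have fP y : D y -> rel y (f y) by move=> yD; exact: (xgetPex 0 yD).
have f0 : D 0 by exists 0 => x _; rewrite !linear0r.
have fD (a : scalar R k) x y : D x -> D y -> D (a *: x + y).
  by move=> [z xz] [z' yz']; exists (a *: z + z'); exact: rel_lin.
have fl (a : scalar R k) x y : D x -> D y -> f (a *: x + y) = a *: f x + f y.
  move=> Dx Dy; apply: (relP (a *: x + y)); first exact: fP (fD _ _ _ Dx Dy).
  by apply: rel_lin; exact: fP.
have fo x : ~ D x -> f x = 0.
  by move=> nDx; apply: xgetPN => z xz; apply: nDx; exists z.
exists (Operator f0 fD fl fo) => y z; split => /= [[Dy <-]|yz]; first exact: fP.
have Dy : D y by exists z.
by split=> //; exact: relP (fP _ Dy) yz.
Qed.

Let comb_continuous (a : scalar R k) (q : H * H) :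
  continuous (fun p : H * H => a *: p + q).
Proof.
by move=> p; apply: cvgD; [apply: cvgZr; exact: cvg_id | exact: cvg_cst].
Qed.

Let comb_continuousr (a : scalar R k) (q : H * H) :
  continuous (fun p : H * H => a *: q + p).
Proof. by move=> p; apply: cvgD; [exact: cvg_cst | exact: cvg_id]. Qed.

Let closure_homo (f : H * H -> H * H) (G : set (H * H)) : continuous f ->
  (forall p, G p -> closure G (f p)) -> forall p, closure G p -> closure G (f p).
Proof.
move=> cf GG p; rewrite {1}closureE => /(_ (f @^-1` closure G)); apply.
split=> //; apply: preimage_closed (@closed_closure _ G) => ? _; exact: cf.
Qed.

Lemma op_closureP (T : operator) :
  closeable T -> is_op_closure T (op_closure T).
Proof.
move=> [S [cS TS]]; suff [C hC] : exists C, is_op_closure T C.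
  exact: (xgetPex T (ex_intro _ C hC)).
have gle (U V : operator) : op_ext U V -> graph U `<=` graph V.
  by move=> [UV eUV] [x y] [/= Ux ->]; split=> /=; [exact: UV | rewrite eUV].
pose G := closure (graph T).
have min (V : operator) : closed_op V -> op_ext T V -> G `<=` graph V.
  by move=> cV /gle TV p; rewrite /G closureE => /(_ (graph V)); apply.
have Glin (a : scalar R k) p q : G p -> G q -> G (a *: p + q).
  move=> Gp Gq; move: p Gp; apply: closure_homo => [|p Tp].
    exact: comb_continuous.
  move: q Gq; apply: closure_homo => [|q Tq]; first exact: comb_continuousr.
  apply: subset_closure; case: p q Tp Tq => [x y] [x' y'] [/= Tx ->] [/= Tx' ->].
  by split=> /=; [exact: dom_linear | rewrite op_linear].
have GS p : G p -> dom S p.1 /\ p.2 = S p.1 by exact: min.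
have TG x : dom T x -> G (x, T x) by move=> Tx; exact: subset_closure.
pose D : set H := [set x | G (x, S x)].
pose f (x : H) : H := if `[< D x >] then S x else 0.
have fE x : D x -> f x = S x by rewrite /f => /asboolP ->.
have f0 : D 0.
  have := TG _ (dom0 T) => G0; rewrite /D /=.
  by have [_ /= <-] := GS _ G0.
have fD (a : scalar R k) x y : D x -> D y -> D (a *: x + y).
  move=> Dx Dy; have Gxy := Glin a _ _ Dx Dy; rewrite /D /=.
  by have [_ /= <-] := GS _ Gxy.
have fl (a : scalar R k) x y : D x -> D y -> f (a *: x + y) = a *: f x + f y.
  move=> Dx Dy; rewrite !fE//; last exact: fD.
  by have [_ /= <-] := GS _ (Glin a _ _ Dx Dy).
have fo x : ~ D x -> f x = 0 by rewrite /f => /asboolPn /negbTE ->.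
have gC : graph (Operator f0 fD fl fo) = G.
  apply/seteqP; split=> -[x y] /=.
    by move=> [/= Dx ->]; rewrite fE.
  move=> Gxy; have [_ /= yS] := GS _ Gxy.
  have Dx : D x by rewrite /D /= -yS.
  by split=> //=; rewrite fE.
exists (Operator f0 fD fl fo); split.
- by rewrite /closed_op gC; exact: closed_closure.
- split=> /= x Tx; have GT := TG _ Tx; have [_ /= eT] := GS _ GT.
    by rewrite /D /= -eT.
  by rewrite fE /D /= -eT.
- move=> V cV TV; split=> /= x Dx; have [/= Vx eV] := min _ cV TV _ Dx => //.
  by rewrite fE.
Qed.

End Operators.
Arguments operator {R k} H.

Declare Scope operator_scope.
Delimit Scope operator_scope with op.
Bind Scope operator_scope with operator.
Notation "A * B" := (op_mul A B) : operator_scope.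
Notation "T ^*" := (adjoint T) : operator_scope.
Notation "S `<=` T" := (op_ext S T) : operator_scope.
Notation "\clos T" := (op_closure T)
  (at level 10, T at level 8, format "\clos  T") : operator_scope.

(* Main.v *)
Require Import Defs.
From mathcomp Require Import all_boot all_order all_algebra.
From mathcomp Require Import all_classical all_reals all_analysis.
From mathcomp Require Import sesquilinear complex ring lra.

Set Implicit Arguments.
Unset Strict Implicit.
Unset Printing Implicit Defensive.
Import Order.TTheory GRing.Theory Num.Theory.
Import numFieldNormedType.Exports.
Local Open Scope classical_set_scope.
Local Open Scope ring_scope.

(** Two facts about a densely defined closeable operator T carry the theorem:
    its adjoint is densely defined, and its second adjoint is its closure.
    Both come from the graph.  Up to the rotation (x, y) |-> (y, -x), the graph
    of the adjoint is the orthogonal complement of the graph of T in the product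
    H * H.  When T is closed, projecting a point (x, y) on the graph writes it
    as (a, T a) + (x - a, s), where s lies in the domain of the adjoint and is
    sent to a - x [closed_decomposition].  For x = 0 and y orthogonal to the
    domain of the adjoint this forces y = 0, whence density
    [adjoint_dense_closed]; for (x, y) in the graph of the second adjoint it
    forces x = a and s = 0, so that (x, y) is in the graph of T
    [biadjoint_closed].  The closeable case reduces to the closed one because T
    and its closure have the same adjoint [adjoint_closure].

    The projection comes from minimizing the distance to a subspace G of H * H
    [orthogonal_decomposition]: by the parallelogram identity a minimizing
    sequence is Cauchy, so it converges to a point of the closure of G.  The
    scalars may be real or complex, and both cases are treated at once by
    replacing the inner product with its real part.  This is harmless: being
    orthogonal to a complex subspace for the real part already gives
    orthogonality for the inner product itself.

    The theorem then follows formally.  The adjoint of A B extends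
    C = B^* A^* [adjoint_mul], and so does the adjoint of the product M of the
    closures, because A and B have the same adjoints as their closures.  Hence,
    if C is densely defined, the adjoints of A B and of M are too, so both
    products are closeable.  The same inclusion applied to B^* and A^*, together
    with A^*^* = \clos A and B^*^* = \clos B, shows that the adjoint of C
    extends M.  All remaining relations follow by taking adjoints, which
    reverses inclusions. *)

(** * Real parts of scalars *)

Section RealPart.
Context {R : realType} {k : scalar_kind}.
Implicit Types z w : Defs.scalar R k.

Definition re : Defs.scalar R k -> R :=
  match k return Defs.scalar R k -> R with
  | RealScalars => idfun
  | ComplexScalars => @complex.Re R
  end.

Definition of_real : R -> Defs.scalar R k :=
  match k return R -> Defs.scalar R k with
  | RealScalars => idfun
  | ComplexScalars => real_complex R
  end.

Lemma reD z w : re (z + w) = re z + re w.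
Proof. by rewrite /re; case: k z w => //= -[? ?] [? ?]. Qed.

Lemma reB z w : re (z - w) = re z - re w.
Proof. by rewrite /re; case: k z w => //= -[? ?] [? ?]. Qed.

Lemma reM r z : re (of_real r * z) = r * re z.
Proof.
rewrite /re /of_real; case: k z => //= -[a b] /=.
by rewrite mul0r subr0.
Qed.

Lemma re_conj z : re (conj_scalar R k z) = re z.
Proof. by rewrite /re /conj_scalar; case: k z => //= -[]. Qed.

Lemma reK z : 0 <= z -> of_real (re z) = z.
Proof.
rewrite /re /of_real; case: k z => //= z z0.
by rewrite RRe_real// ger0_real.
Qed.

Lemma re_ge0 z : 0 <= z -> 0 <= re z.
Proof.
by rewrite /re; case: k z => //= -[a b]; rewrite lecE /= => /andP[].
Qed.

Lemma ltr_of_real r s : (of_real r < of_real s) = (r < s).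
Proof. by rewrite /of_real; case: k => //=; rewrite ltcR. Qed.

Lemma of_real0 : of_real 0 = 0.
Proof. by rewrite /of_real; case: k. Qed.

Lemma of_real1 : of_real 1 = 1.
Proof. by rewrite /of_real; case: k. Qed.

(** The imaginary part of z is recovered by taking w = i. *)
Lemma re_nondegenerate z : (forall w, re (w * z) = 0) -> z = 0.
Proof.
rewrite /re; case: k z => //= z; first by move=> /(_ 1); rewrite mul1r.
move=> h; case: z h => a b h.
have := h 1; rewrite mul1r /= => ->.
have := h (0 +i* 1)%C; rewrite /= mul0r mul1r sub0r => /eqP.
by rewrite oppr_eq0 => /eqP ->.
Qed.
End RealPart.

(** The discriminant condition, stated so as to cover q = 0 as well, where a
    nonnegative affine function must be constant. *)
Lemma quadratic_ge0 (R : realFieldType) (q c e : R) :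
  (forall t, 0 <= t ^+ 2 * q - 2 * t * c + e) -> 0 <= q -> c ^+ 2 <= e * q.
Proof.
move=> h; rewrite le_eqVlt => /predU1P[q0|q0].
  rewrite -q0 mulr0 expr2; have [->|c0] := eqVneq c 0; first by rewrite mulr0.
  have := h ((e + 1) / (2 * c)); rewrite -q0 mulr0.
  have -> : 2 * ((e + 1) / (2 * c)) * c = e + 1 by field.
  lra.
have := h (c / q).
have -> : (c / q) ^+ 2 * q - 2 * (c / q) * c + e = (e * q - c ^+ 2) / q.
  by field; rewrite gt_eqF.
by rewrite pmulr_lge0 ?invr_gt0// subr_ge0.
Qed.

(** * The real inner product *)

Section RealInner.
Context {R : realType} {k : scalar_kind} {H : hilbertType R k}.
Implicit Types (x y z : H) (p q : H * H).

Definition rin x y : R := re (inner H x y).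

Lemma rinC x y : rin x y = rin y x.
Proof.
rewrite /rin.
have -> : inner H x y = (-1) ^+ false * conj_scalar R k (inner H y x).
  exact: hermitian_subproof.
by rewrite expr0 mul1r re_conj.
Qed.

Lemma rinD x y z : rin (x + y) z = rin x z + rin y z.
Proof. by rewrite /rin linearDl/= reD. Qed.

Lemma rinZ r x y : rin (of_real r *: x) y = r * rin x y.
Proof. by rewrite /rin linearZl/= reM. Qed.

Lemma rinB x y z : rin (x - y) z = rin x z - rin y z.
Proof. by rewrite /rin linearBl/= reB. Qed.

Lemma rin0 x : rin 0 x = 0.
Proof. by rewrite -(subrr x) rinB subrr. Qed.

Lemma rinN x y : rin (- x) y = - rin x y.
Proof. by rewrite -sub0r rinB rin0 sub0r. Qed.

Lemma rinBr x y z : rin z (x - y) = rin z x - rin z y.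
Proof. by rewrite !(rinC z) rinB. Qed.

Lemma rin_norm x : rin x x = (re `|x|) ^+ 2.
Proof.
by rewrite /rin inner_norm expr2 -{1}(reK (normr_ge0 x)) reM -expr2.
Qed.

Lemma norm_lt_rin x (e : R) : 0 < e -> (`|x| < of_real e) = (rin x x < e ^+ 2).
Proof.
move=> e0; rewrite rin_norm ltr_pXn2r// ?nnegrE ?(ltW e0)//.
  by rewrite -(@ltr_of_real _ k) reK.
exact: re_ge0.
Qed.

(** The hilbertian structure of the product, whose own norm is a maximum and
    does not come from an inner product. *)
Definition pin p q : R := rin p.1 q.1 + rin p.2 q.2.

Lemma pinC p q : pin p q = pin q p.
Proof. by rewrite /pin rinC (rinC p.2). Qed.

Lemma pinZ a p q : pin (of_real a *: p) q = a * pin p q.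
Proof. by rewrite /pin !rinZ mulrDr. Qed.

Lemma pinB p q r : pin (p - q) r = pin p r - pin q r.
Proof. by rewrite /pin !rinB; ring. Qed.

Lemma pinBr p q r : pin r (p - q) = pin r p - pin r q.
Proof. by rewrite !(pinC r) pinB. Qed.

Lemma rin_ge0 x : 0 <= rin x x.
Proof. by rewrite rin_norm sqr_ge0. Qed.

Lemma rin_eq0 x : rin x x = 0 -> x = 0.
Proof.
rewrite rin_norm => /eqP; rewrite sqrf_eq0 => /eqP x0.
by apply/eqP; rewrite -normr_eq0 -(reK (normr_ge0 x)) x0 of_real0.
Qed.

Lemma pin_ge0 p : 0 <= pin p p.
Proof. by rewrite addr_ge0// rin_ge0. Qed.

Lemma rin_cauchy_schwarz x y : rin x y ^+ 2 <= rin x x * rin y y.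
Proof.
apply: quadratic_ge0 => [t|]; last exact: rin_ge0.
suff -> : t ^+ 2 * rin y y - 2 * t * rin x y + rin x x =
    rin (x - of_real t *: y) (x - of_real t *: y) by exact: rin_ge0.
by rewrite !rinB !rinBr !rinZ !(rinC _ (of_real t *: y)) !rinZ (rinC y x); ring.
Qed.

Lemma rin_continuous y : continuous (fun x => rin x y).
Proof.
move=> x; apply/cvgrPdist_lt => e e0.
pose d := e / (rin y y + 1).
have y1 : 0 < rin y y + 1 by have := rin_ge0 y; lra.
have d0 : 0 < d by rewrite divr_gt0.
have d0k : 0 < of_real d :> Defs.scalar R k by rewrite -of_real0 ltr_of_real.
near=> z.
rewrite -rinB; set u := x - z.
have ud : rin u u < d ^+ 2.
  rewrite -norm_lt_rin// /u; near: z.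
  by apply: (@cvgr_dist_lt _ _ _ _ _ id x _ _ d0k); exact: cvg_id.
rewrite -(@ltr_pXn2r _ 2)// ?nnegrE ?(ltW e0)// real_normK ?num_real//.
apply: le_lt_trans (rin_cauchy_schwarz u y) _.
have -> : e = d * (rin y y + 1) by rewrite divfK// gt_eqF.
have := rin_ge0 y; have := rin_ge0 u; nra.
Unshelve. all: by end_near. Qed.

Lemma pin_subZ p q t : pin (p - of_real t *: q) (p - of_real t *: q) =
  t ^+ 2 * pin q q - 2 * t * pin q p + pin p p.
Proof.
rewrite !pinBr !pinB !(pinC _ (of_real t *: q)) !pinZ.
by rewrite !(pinC _ (of_real t *: q)) !pinZ; ring.
Qed.

Lemma pin_continuous q : continuous (fun p => pin p q).
Proof.
move=> p.
apply: (@cvgD _ R^o _ _ _ (fun r => rin r.1 q.1) (fun r => rin r.2 q.2)).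
  apply: (continuous_comp (f := fst) (g := fun x => rin x q.1)).
    exact: cvg_fst.
  exact: rin_continuous.
apply: (continuous_comp (f := snd) (g := fun x => rin x q.2)).
  exact: cvg_snd.
exact: rin_continuous.
Qed.

(** * Orthogonal decomposition in the product *)

(** The bound has the form produced by the parallelogram identity for elements
    whose squared distances to a point exceed the infimum by at most 1/(n+1). *)
Lemma rin_cauchy_cvg (u : nat -> H) :
  (forall n m, rin (u n - u m) (u n - u m) <= 2 / n.+1%:R + 2 / m.+1%:R) ->
  cvg (u @ \oo).
Proof.
have sum4 (E a b : R) : a < E / 4 -> b < E / 4 -> 2 * b + 2 * a < E by lra.
move=> hu; apply: cauchy_cvg; apply: cauchy_exP => e e0.
have re0 : 0 < re e by rewrite -(@ltr_of_real _ k) of_real0 reK// ltW.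
have d0 : 0 < re e ^+ 2 / 4 by rewrite divr_gt0// exprn_gt0.
have /cvgrPdist_lt /(_ _ d0) := @cvg_harmonic R.
move=> -[N _ hN].
exists (u N); exists N => // n /= Nn.
rewrite -ball_normE /= -(reK (ltW e0)) norm_lt_rin//.
apply: le_lt_trans (hu N n) _.
have := hN N (leqnn N); have := hN n Nn; rewrite /= !sub0r !normrN !ger0_norm//.
exact: sum4.
Qed.

(** The subspace G need not be closed: g is the limit of a minimizing sequence
    in G, so it is only known to lie in the closure.  This generality serves
    [dense_orthogonal_eq0], where G is not closed. *)
Lemma orthogonal_decomposition (G : set (H * H)) (p : H * H) :
  G 0 ->
  (forall (a : Defs.scalar R k) q r, G q -> G r -> G (a *: q + r)) ->
  exists2 g, closure G g & forall q, G q -> pin q (p - g) = 0.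
Proof.
have low (c e s a b : R) : s < c + e -> c <= a - b + s -> 0 <= a - b + e.
  by lra.
have mid (c e1 e2 s x y : R) : s < c + e2 -> s - 2 * x + y < c + e1 ->
    c <= 2^-1 ^+ 2 * y - 2 * 2^-1 * x + s -> y <= 2 * e1 + 2 * e2.
  by lra.
move=> G0 Glin.
pose S g := pin (p - g) (p - g).
pose d := inf (S @` G).
have lbS : has_lbound (S @` G) by exists 0 => _ [g _ <-]; exact: pin_ge0.
have Sd g : G g -> d <= S g by move=> Gg; apply: ge_inf => //; exists g.
have /choice[g gP] : forall n : nat, exists g, G g /\ S g < d + n.+1%:R^-1.
  move=> n; have n0 : 0 < n.+1%:R^-1 :> R by rewrite invr_gt0.
  have [|_ [g Gg <-] gd] := @inf_adherent _ (S @` G) _ n0.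
    by split=> //; exists (S 0), 0.
  by exists g.
have Gg n : G (g n) := (gP n).1.
have perp q n : G q -> pin q (p - g n) ^+ 2 <= n.+1%:R^-1 * pin q q.
  (* Moving g n by t q inside G cannot bring it closer than the infimum, so a
     quadratic polynomial in t, of constant term 1/(n+1), stays nonnegative. *)
  move=> Gq; apply: quadratic_ge0 => [t|]; last exact: pin_ge0.
  have := Sd _ (Glin (of_real t) _ _ Gq (Gg n)); have := (gP n).2.
  rewrite /S (addrC _ (g n)) opprD addrA pin_subZ.
  exact: low.
have gcauchy n m :
    pin (g n - g m) (g n - g m) <= 2 / n.+1%:R + 2 / m.+1%:R.
  (* The parallelogram identity: compare with the midpoint of g n and g m. *)
  pose w := g n - g m.
  have Gw : G (of_real 2^-1 *: w + g m).
    by apply: (Glin _ _ _ _ (Gg m)); rewrite /w addrC -scaleN1r; apply: Glin.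
  have Sw t : S (of_real t *: w + g m) =
      t ^+ 2 * pin w w - 2 * t * pin w (p - g m) + S (g m).
    by rewrite /S (addrC _ (g m)) opprD addrA pin_subZ.
  have Sn := Sw 1; rewrite of_real1 scale1r subrK in Sn.
  have := Sd _ Gw; rewrite Sw; have := (gP n).2; have := (gP m).2.
  have -> : S (g n) = S (g m) - 2 * pin w (p - g m) + pin w w.
    by rewrite Sn; ring.
  exact: mid.
have /cvg_ex[a ga] : cvg ((fst \o g) @ \oo).
  apply: rin_cauchy_cvg => n m; apply: le_trans (gcauchy n m).
  by rewrite lerDl rin_ge0.
have /cvg_ex[b gb] : cvg ((snd \o g) @ \oo).
  apply: rin_cauchy_cvg => n m; apply: le_trans (gcauchy n m).
  by rewrite lerDr rin_ge0.
have gab : g @ \oo --> (a, b).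
  have -> : g = fun n => ((fst \o g) n, (snd \o g) n).
    by apply/funext => n; exact: surjective_pairing.
  exact: (cvg_pair ga gb).
exists (a, b).
  apply: (closed_cvg _ (@closed_closure _ G) _ _ gab).
  by near=> n; exact: subset_closure.
move=> q Gq; apply/eqP; rewrite -sqrf_eq0 eq_le sqr_ge0 andbT.
have cv : (fun n => pin q (p - g n) ^+ 2) @ \oo --> pin q (p - (a, b)) ^+ 2.
  have c1 : (fun n => pin q (p - g n)) @ \oo --> pin q (p - (a, b)).
    have -> : (fun n => pin q (p - g n)) =
        (fun r => pin r q) \o (fun n => p - g n).
      by apply/funext => n /=; rewrite pinC.
    rewrite pinC; apply: (@cvg_comp _ _ _ _ _ _ (nbhs (p - (a, b)))).
      by apply: (@cvgB _ (H * H)%type) gab; exact: cvg_cst.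
    exact: pin_continuous.
  by rewrite expr2; under eq_fun do rewrite expr2; exact: cvgM.
have c0 : (fun n => n.+1%:R^-1 * pin q q) @ \oo --> (0 : R).
  rewrite -[X in _ --> X](mul0r (pin q q)).
  by apply: cvgM; [exact: cvg_harmonic | exact: cvg_cst].
apply: (ler_cvg_to cv c0); near=> n; exact: perp.
Unshelve. all: by end_near. Qed.

End RealInner.

(** * Partially defined operators *)

Section Adjoints.
Context {R : realType} {k : scalar_kind} {H : hilbertType R k}.
Implicit Types (x y z : H) (S T K : operator H).
Local Open Scope operator_scope.

Lemma op_mul_ext S S' T T' : S `<=` S' -> T `<=` T' -> S * T `<=` S' * T'.
Proof.
move=> [SS eS] [TT eT]; split=> /= x [Tx STx].
  by split; [exact: TT | rewrite eT//; exact: SS].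
rewrite !asboolT //; first by rewrite eT// eS.
by split; [exact: TT | rewrite eT//; exact: SS].
Qed.

Lemma op_mulE S T x : dom T x -> dom S (T x) -> (S * T) x = S (T x).
Proof. by move=> Tx STx /=; rewrite asboolT. Qed.

Lemma op0 T : T 0 = 0 :> H.
Proof.
have := op_linear (-1) (dom0 T) (dom0 T).
by rewrite scaler0 addr0 scaleN1r addNr.
Qed.

Lemma graph0 T : graph T 0.
Proof. by split; [exact: dom0 | rewrite op0]. Qed.

Lemma graph_linear T (a : Defs.scalar R k) (p q : H * H) :
  graph T p -> graph T q -> graph T (a *: p + q).
Proof.
case: p q => [x y] [x' y'] [/= Tx ->] [/= Tx' ->].
by split=> /=; [exact: dom_linear | rewrite op_linear].
Qed.

Lemma graph_ext S T : S `<=` T <-> (graph S `<=` graph T)%classic.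
Proof.
split=> [[ST e] [x y] [/= Sx ->]|ST].
  by split=> /=; [exact: ST | rewrite e].
by split=> x Sx; have [/=] := ST (x, S x) (conj Sx erefl).
Qed.

Lemma densely_defined_ext S T :
  S `<=` T -> densely_defined S -> densely_defined T.
Proof.
by move=> [ST _] dS O On Oo; have [x [Ox /ST Tx]] := dS O On Oo; exists x.
Qed.

(** If a point z decomposes as g + r with g in the closure of D and r orthogonal
    to D, then r = 0 and z is itself in the closure. *)
Lemma dense_orthogonal_eq0 (D : set H) :
  D 0 ->
  (forall (a : Defs.scalar R k) x y, D x -> D y -> D (a *: x + y)) ->
  (forall z, (forall x, D x -> rin x z = 0) -> z = 0) -> dense D.
Proof.
(* The cylinder over D puts D inside the product, where decompositions are
   available; only the first components matter. *)
move=> D0 Dlin Dperp O [z Oz] oO.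
have [//||[a b] cab perp] :=
  @orthogonal_decomposition _ _ _ (fst @^-1` D) (z, 0).
- by move=> c [x x'] [y y']; exact: Dlin.
- suff za : z = a.
    have [|[x x'] [/= Dx Ox]] := cab (fst @^-1` O); last by exists x.
    by apply: cvg_fst; rewrite -za; exact: open_nbhs_nbhs.
  apply/eqP; rewrite -subr_eq0; apply/eqP/Dperp => x Dx.
  by have := perp (x, 0) Dx; rewrite /pin /= rin0 addr0.
Qed.

(** * Adjoints and closures *)

(** The domain of T is stable under complex scalars, so the adjoint relation for
    the real part of the inner product implies the full one. *)
Lemma adjointE T y z : densely_defined T ->
  graph (T^*) (y, z) <-> (forall x, dom T x -> rin (T x) y = rin x z).
Proof.
move=> /adjointP/(_ y z) tT; rewrite /graph /=; split=> [[yT /esym zE] x Tx|h].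
  by rewrite /rin (tT.1 (conj yT zE)).
suff /tT[? ->] : forall x, dom T x -> inner H (T x) y = inner H x z by [].
move=> x Tx; apply/eqP; rewrite -subr_eq0; apply/eqP/re_nondegenerate => w.
have Twx : dom T (w *: x) by rewrite -[w *: x]addr0; exact: dom_linear (dom0 T).
have TwxE : T (w *: x) = w *: T x.
  by rewrite -[w *: x]addr0 op_linear ?op0 ?addr0//; exact: dom0.
have := h _ Twx; rewrite TwxE /rin !linearZl/= => e.
by rewrite mulrBr reB e subrr.
Qed.

Lemma adjoint_swap T x y : densely_defined T -> dom T x -> dom (T^*) y ->
  rin (T x) y = rin x (T^* y).
Proof. by move=> dT Tx Ty; exact: (adjointE y (T^* y) dT).1. Qed.

(** Each adjoint relation is a continuous condition on the pair, so the graph of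
    the adjoint is an intersection of closed sets. *)
Lemma adjoint_closed T : densely_defined T -> closed_op (T^*).
Proof.
move=> dT; rewrite /closed_op.
have -> : graph (T^*) =
    \bigcap_(x in dom T) [set p | pin p (T x, - x) = 0].
  apply/seteqP; split=> -[y z].
    move=> /(adjointE y z dT) h x Tx.
    by rewrite /pin /= (rinC y) (rinC z) rinN h// subrr.
  move=> h; apply/adjointE => // x Tx; apply/eqP; rewrite -subr_eq0.
  by have := h x Tx; rewrite /pin /= (rinC y) (rinC z) rinN => ->.
apply: closed_bigI => x _.
apply: (@preimage_closed _ _ _ [set 0]); last by apply: (@closed_eq R).
by move=> ? _; exact: pin_continuous.
Qed.

Lemma adjoint_anti S T : densely_defined S -> S `<=` T -> T^* `<=` S^*.
Proof.
move=> dS ST; have dT := densely_defined_ext ST dS.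
apply/graph_ext => -[y z] /(adjointE y z dT) h; apply/adjointE => // x Sx.
by rewrite -ST.2// h//; exact: ST.1.
Qed.

Lemma adjoint_mul S T : densely_defined S -> densely_defined T ->
  densely_defined (S * T) -> T^* * S^* `<=` (S * T)^*.
Proof.
move=> dS dT dST; apply/graph_ext => -[y z] [[Sy TSy] zE].
have {}zE : z = T^* (S^* y) := etrans zE (op_mulE Sy TSy).
apply/adjointE => // x [Tx STx]; rewrite op_mulE// adjoint_swap//.
by rewrite adjoint_swap// zE.
Qed.

Lemma op_ext_biadjoint T :
  densely_defined T -> densely_defined (T^*) -> T `<=` T^*^*.
Proof.
move=> dT dT'; apply/graph_ext => -[x y] [/= Tx ->].
by apply/adjointE => // z Tz; rewrite rinC -adjoint_swap// rinC.
Qed.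

(** The projection of (x, y) on the closed graph of K is (a, K a).
    Orthogonality of the remainder (x - a, s) to all (u, K u) says exactly that
    s is sent to a - x by the adjoint. *)
Lemma closed_decomposition K x y : closed_op K -> densely_defined K ->
  exists a s, [/\ dom K a, graph (K^*) (s, a - x) & y = K a + s].
Proof.
move=> cK dK.
have [g cg perp] :=
  orthogonal_decomposition (x, y) (graph0 K) (@graph_linear K).
have [/= Ka gE] := cK _ cg.
exists g.1, (y - K g.1); split=> //; last by rewrite addrC subrK.
apply/adjointE => // u Ku.
have := perp (u, K u) (conj Ku erefl); rewrite /pin /= gE => /eqP.
by rewrite addrC addr_eq0 => /eqP ->; rewrite !rinBr opprB.
Qed.

(** For z orthogonal to the domain of the adjoint, z = K a + s with a the image
    of s, so that 0 = <z, s> = |a|^2 + |s|^2. *)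
Lemma adjoint_dense_closed K : closed_op K -> densely_defined K ->
  densely_defined (K^*).
Proof.
move=> cK dK; apply: dense_orthogonal_eq0; [exact: dom0|exact: dom_linear|].
move=> z zperp.
have [a [s [Ka]]] := closed_decomposition 0 z cK dK.
rewrite subr0 => -[/= Ks aE] zE.
have h : rin a a + rin s s = 0.
  rewrite -(zperp s Ks) zE (rinC s (_ + _)) rinD.
  by rewrite adjoint_swap// -aE.
have a0 : a = 0 by apply: rin_eq0; have := rin_ge0 a; have := rin_ge0 s; lra.
have s0 : s = 0 by apply: rin_eq0; have := rin_ge0 a; have := rin_ge0 s; lra.
by rewrite zE a0 s0 op0 addr0.
Qed.

(** If (x, y) and (a, K a) are both in the graph of the second adjoint, so is
    their difference (x - a, s); since s is sent to a - x by the adjoint, this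
    gives <s, s> = <a - x, x - a>, and both vanish. *)
Lemma biadjoint_closed K : closed_op K -> densely_defined K -> K^*^* = K.
Proof.
move=> cK dK; have dK' := adjoint_dense_closed cK dK.
apply: op_ext_anti; last exact: op_ext_biadjoint.
apply/graph_ext => -[x y] /(adjointE x y dK') xy.
have [a [s [Ka [/= Ks axE] yE]]] := closed_decomposition x y cK dK.
have h : rin (a - x) (a - x) + rin s s = 0.
  have := xy s Ks; have := adjoint_swap dK Ka Ks.
  rewrite -axE yE (rinC s (K a + s)) !(rinBr, rinB) rinD (rinC x a); lra.
have a0 : a - x = 0.
  by apply: rin_eq0; have := rin_ge0 (a - x); have := rin_ge0 s; lra.
have s0 : s = 0.
  by apply: rin_eq0; have := rin_ge0 (a - x); have := rin_ge0 s; lra.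
by move/eqP: a0; rewrite subr_eq0 => /eqP <-; split=> //=; rewrite yE s0 addr0.
Qed.

Lemma op_closure_ext T : closeable T -> T `<=` \clos T.
Proof. by case/op_closureP. Qed.

Lemma op_closure_closed T : closeable T -> closed_op (\clos T).
Proof. by case/op_closureP. Qed.

Lemma op_closure_dense T :
  densely_defined T -> closeable T -> densely_defined (\clos T).
Proof. by move=> dT /op_closure_ext TT; exact: densely_defined_ext TT dT. Qed.

Lemma adjoint_dense T :
  densely_defined T -> closeable T -> densely_defined (T^*).
Proof.
move=> dT cT; have T_cT := op_closure_ext cT.
apply: densely_defined_ext (adjoint_anti dT T_cT) _.
apply: adjoint_dense_closed; first exact: op_closure_closed.
exact: op_closure_dense.
Qed.

Lemma closeable_adjoint_dense T :
  densely_defined T -> densely_defined (T^*) -> closeable T.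
Proof.
move=> dT dT'; exists (T^*^*).
by split; [exact: adjoint_closed | exact: op_ext_biadjoint].
Qed.

(** The second adjoint is a closed extension of T, hence of its closure; so any
    adjoint relation satisfied on the domain of T persists on the closure. *)
Lemma adjoint_closure T :
  densely_defined T -> closeable T -> (\clos T)^* = T^*.
Proof.
move=> dT cT; apply: op_ext_anti; first exact: adjoint_anti (op_closure_ext cT).
have dT' := adjoint_dense dT cT; have dC := op_closure_dense dT cT.
have [_ _ /(_ (T^*^*)) min] := op_closureP cT.
have {min}[CT CTE] := min (adjoint_closed dT') (op_ext_biadjoint dT dT').
apply/graph_ext => -[y z] [/= Ty ->]; apply/adjointE => // x Cx.
by rewrite -CTE// rinC -adjoint_swap//; [rewrite rinC | exact: CT].
Qed.

Lemma biadjoint_closure T :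
  densely_defined T -> closeable T -> T^*^* = \clos T.
Proof.
move=> dT cT; rewrite -(adjoint_closure dT cT) biadjoint_closed//.
  exact: op_closure_closed.
exact: op_closure_dense.
Qed.
End Adjoints.

Local Open Scope operator_scope.

(* A relation in which T^* occurs presupposes that T is densely defined, and
   one in which \clos T occurs presupposes that T is closeable.  These
   presuppositions are part of the conclusion: they are the first two groups of
   conjuncts of the second part. *)
Theorem lemma1 (R : realType) (k : scalar_kind) (H : hilbertType R k)
    (A B : operator H)
    (A_dense : densely_defined A) (A_closeable : closeable A)
    (B_dense : densely_defined B) (B_closeable : closeable B)
    (AB_dense : densely_defined (A * B)) :
  (B^* * A^* `<=` (A * B)^*)
  /\
  (densely_defined (B^* * A^*) ->
   (* closeability *)
   (closeable (A * B) /\ closeable (\clos A * \clos B) /\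
    closeable (B^* * A^*) /\ closeable ((\clos B)^* * (\clos A)^*))
   /\
   (* density of the domains of the operators whose adjoint occurs below *)
   (densely_defined (A^*) /\ densely_defined (B^*) /\
    densely_defined (\clos A) /\ densely_defined (\clos B) /\
    densely_defined ((A * B)^*) /\ densely_defined ((A * B)^*^*) /\
    densely_defined (\clos (A * B)) /\ densely_defined ((\clos (A * B))^*) /\
    densely_defined ((B^* * A^*)^*) /\ densely_defined ((B^* * A^*)^*^*) /\
    densely_defined (\clos (B^* * A^*)) /\
    densely_defined (\clos ((\clos B)^* * (\clos A)^*)) /\
    densely_defined (\clos A * \clos B) /\ densely_defined (A^*^* * B^*^*) /\
    densely_defined ((\clos A * \clos B)^*) /\
    densely_defined (\clos (\clos A * \clos B)) /\
    densely_defined ((\clos (\clos A * \clos B))^*))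
   /\
   ((A * B)^*^* `<=` (B^* * A^*)^* /\
    (A * B)^*^* = \clos (A * B) /\
    A * B `<=` \clos (A * B))
   /\
   (A^*^* * B^*^* `<=` (B^* * A^*)^* /\
    A^*^* * B^*^* = \clos A * \clos B /\
    A * B `<=` \clos A * \clos B)
   /\
   ((A * B)^* = (\clos (A * B))^* /\
    (\clos (A * B))^* = (A * B)^*^*^* /\
    (B^* * A^*)^*^* `<=` (A * B)^*^*^* /\
    B^* * A^* `<=` (B^* * A^*)^*^* /\
    B^* * A^* = (\clos B)^* * (\clos A)^*)
   /\
   ((\clos A * \clos B)^* `<=` (A * B)^* /\
    (\clos A * \clos B)^* = (A^*^* * B^*^*)^* /\
    B^* * A^* `<=` (A^*^* * B^*^*)^* /\
    B^* * A^* = (\clos B)^* * (\clos A)^*)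
   /\
   (\clos (A * B) = (\clos (A * B))^*^* /\
    (\clos (A * B))^*^* `<=` (B^* * A^*)^*^*^* /\
    (B^* * A^*)^*^*^* = (B^* * A^*)^* /\
    (B^* * A^*)^* = (\clos (B^* * A^*))^* /\
    (\clos (B^* * A^*))^* = (\clos ((\clos B)^* * (\clos A)^*))^*)
   /\
   (\clos (A * B) `<=` (\clos A * \clos B)^*^* /\
    (\clos A * \clos B)^*^* = (\clos (\clos A * \clos B))^*^* /\
    (\clos (\clos A * \clos B))^*^* = \clos (\clos A * \clos B) /\
    \clos (\clos A * \clos B) `<=` (B^* * A^*)^*)
   /\
   (A * B `<=` \clos (A * B) /\ \clos (A * B) `<=` (B^* * A^*)^* /\
    A * B `<=` \clos A * \clos B /\ \clos A * \clos B `<=` (B^* * A^*)^*)).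
Proof.
have CAB := adjoint_mul A_dense B_dense AB_dense.
split=> // C_dense.
have A'_dense := adjoint_dense A_dense A_closeable.
have B'_dense := adjoint_dense B_dense B_closeable.
have cA_dense := op_closure_dense A_dense A_closeable.
have cB_dense := op_closure_dense B_dense B_closeable.
have eqC : B^* * A^* = (\clos B)^* * (\clos A)^*.
  by rewrite (adjoint_closure A_dense) // (adjoint_closure B_dense).
have eqM : A^*^* * B^*^* = \clos A * \clos B.
  by rewrite (biadjoint_closure A_dense) // (biadjoint_closure B_dense).
(* M = \clos A \clos B contains A B, and C = B^* A^* lies in its adjoint. *)
have AB_M : A * B `<=` \clos A * \clos B.
  by apply: op_mul_ext; exact: op_closure_ext.
have M_dense := densely_defined_ext AB_M AB_dense.
have C_M' : B^* * A^* `<=` (\clos A * \clos B)^*.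
  by rewrite eqC; exact: adjoint_mul.
have AB'_dense := densely_defined_ext CAB C_dense.
have M'_dense := densely_defined_ext C_M' C_dense.
have AB_closeable := closeable_adjoint_dense AB_dense AB'_dense.
have M_closeable := closeable_adjoint_dense M_dense M'_dense.
have M_C' : \clos A * \clos B `<=` (B^* * A^*)^*.
  by rewrite -eqM; exact: adjoint_mul.
have C'_dense := densely_defined_ext M_C' M_dense.
have C_closeable := closeable_adjoint_dense C_dense C'_dense.
have AB'' := biadjoint_closure AB_dense AB_closeable.
have M'' := biadjoint_closure M_dense M_closeable.
have C'' := biadjoint_closure C_dense C_closeable.
have cAB_dense := op_closure_dense AB_dense AB_closeable.
have cM_dense := op_closure_dense M_dense M_closeable.
have cC_dense := op_closure_dense C_dense C_closeable.
have cAB' := adjoint_closure AB_dense AB_closeable.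
have cM' := adjoint_closure M_dense M_closeable.
have cC' := adjoint_closure C_dense C_closeable.
have AB_cAB := op_closure_ext AB_closeable.
have C_cC := op_closure_ext C_closeable.
have M'_AB' := adjoint_anti AB_dense AB_M.
have cAB_C' : \clos (A * B) `<=` (B^* * A^*)^*.
  by rewrite -AB''; exact: adjoint_anti.
have cM_C' : \clos (\clos A * \clos B) `<=` (B^* * A^*)^*.
  by rewrite -M''; exact: adjoint_anti.
have cC_AB' : \clos (B^* * A^*) `<=` (A * B)^*.
  by rewrite -C'' -cAB'; exact: adjoint_anti.
have cAB_cM : \clos (A * B) `<=` \clos (\clos A * \clos B).
  by rewrite -AB'' -M''; exact: adjoint_anti.
(* Every second adjoint becomes a closure and every adjoint of a closure the
   adjoint itself; each conjunct is then trivial or one of the facts above. *)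
by rewrite -?eqC ?eqM ?(AB'', M'', C'', cAB', cM', cC').
Qed.
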